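(* Let $\hbar>0$, $n\ge1$, let $\sigma$ be a symbol on $\hbar\mathbb{Z}^n\times\mathbb{T}^n$ and let $C(\cdot),\omega(\cdot)$ be functions on $\hbar\mathbb{Z}^n$ such that $$|(\mathcal{F}_{\mathbb{T}^n}\sigma)(k,m)|\le C(k)\,\omega(m)\qquad\text{for every }k,m\in\hbar\mathbb{Z}^n .$$ Let $p,q$ be conjugate exponents, $\frac1p+\frac1q=1$. Then: (i) $T_\sigma\in\mathcal{B}(\ell^1(\hbar\mathbb{Z}^n),\ell^p(\hbar\mathbb{Z}^n))$ with $1\le p<\infty$ if $C(\cdot)\in\ell^p(\hbar\mathbb{Z}^n)$ and $\omega(\cdot)\in\ell^\infty(\hbar\mathbb{Z}^n)$. (ii) $T_\sigma\in\mathcal{B}(\ell^1(\hbar\mathbb{Z}^n),\ell^\infty(\hbar\mathbb{Z}^n))$ if $C(\cdot),\omega(\cdot)\in\ell^\infty(\hbar\mathbb{Z}^n)$. (iii) $T_\sigma\in\mathcal{B}(\ell^p(\hbar\mathbb{Z}^n))$ with $1<p$ if $C(\cdot)\in\ell^p(\hbar\mathbb{Z}^n)$ and $\omega(\cdot)\in\ell^q(\hbar\mathbb{Z}^n)$.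
   Context: $\hbar\mathbb{Z}^n=\{\hbar z:z\in\mathbb{Z}^n\}$, $\mathbb{T}^n=\mathbb{R}^n/\mathbb{Z}^n$ (identified with $[0,1)^n$). A symbol is a measurable function $\sigma:\hbar\mathbb{Z}^n\times\mathbb{T}^n\to\mathbb{C}$ with $\sigma(k,\cdot)$ integrable for each $k$, and $$(\mathcal{F}_{\mathbb{T}^n}\sigma)(k,m)=\int_{\mathbb{T}^n}\sigma(k,\theta)e^{-2\pi\frac i\hbar m\cdot\theta}\,d\theta,\qquad k,m\in\hbar\mathbb{Z}^n .$$ The pseudo-differential operator is $(T_\sigma a)(k)=\int_{\mathbb{T}^n}e^{2\pi\frac i\hbar k\cdot\theta}\sigma(k,\theta)\hat a(\theta)\,d\theta$ with $\hat a(\theta)=\sum_{k\in\hbar\mathbb{Z}^n}a(k)e^{-2\pi\frac i\hbar k\cdot\theta}$; equivalently it is given by its associated matrix, $(T_\sigma a)(k)=\sum_{m\in\hbar\mathbb{Z}^n}a_{k,m}a(m)$ with $a_{k,m}=\int_{\mathbb{T}^n}\sigma(k,\theta)e^{2\pi\frac i\hbar(k-m)\cdot\theta}d\theta=(\mathcal{F}_{\mathbb{T}^n}\sigma)(k,m-k)$, and on $\ell^p$ spaces $T_\sigma$ is understood as this matrix operator. $\mathcal{B}(X,Y)$ denotes bounded linear operators from $X$ to $Y$, $\mathcal{B}(X)=\mathcal{B}(X,X)$. *)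

(* Defs.v *)
From HB Require Import structures.
From mathcomp Require Import all_boot all_order all_algebra.
From mathcomp Require Import all_classical all_reals all_analysis.
From mathcomp Require summability.
From mathcomp Require Import complex.

Set Implicit Arguments.
Unset Strict Implicit.
Unset Printing Implicit Defensive.

Import Order.TTheory GRing.Theory Num.Theory.
Import numFieldNormedType.Exports.
Import ComplexField.Normc.

Local Open Scope classical_set_scope.
Local Open Scope ring_scope.
Local Open Scope complex_scope.

Section LebesgueTuple.
Context {R : realType}.

Definition cons_pair n (x : R * n.-tuple R) : n.+1.-tuple R :=
  [tuple of x.1 :: x.2].

Lemma measurable_cons_pair n : measurable_fun [set: _] (@cons_pair n).
Proof. exact: measurable_cons measurable_fst measurable_snd. Qed.

Section Step.
Variables (n : nat) (mu : {sigma_finite_measure set (n.-tuple R) -> \bar R}).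

Definition lebesgue_cons : set (n.+1.-tuple R) -> \bar R :=
  pushforward (@lebesgue_measure R \x mu)%E (@cons_pair n).

Let lebesgue_cons0 : lebesgue_cons set0 = 0%E.
Proof. by rewrite /lebesgue_cons /pushforward preimage_set0 measure0. Qed.

Let lebesgue_cons_ge0 A : (0 <= lebesgue_cons A)%E.
Proof. by rewrite /lebesgue_cons /pushforward measure_ge0. Qed.

Let lebesgue_cons_sigma_additive : semi_sigma_additive lebesgue_cons.
Proof.
exact: (@measure_semi_sigma_additive _ _ _
  (measure_function_pushforward__canonical__measure_function_Measure
     (@lebesgue_measure R \x mu)%E (@measurable_cons_pair n))).
Qed.

HB.instance Definition _ := isMeasure.Build _ _ _ lebesgue_cons
  lebesgue_cons0 lebesgue_cons_ge0 lebesgue_cons_sigma_additive.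

Let lebesgue_cons_sigma_finite : sigma_finite [set: _] lebesgue_cons.
Proof.
have [F FT Foo] : sigma_finite [set: _] (@lebesgue_measure R \x mu)%E.
  have /sigma_finiteP[F [TF ndF Foo]] := sigma_finiteT (@lebesgue_measure R).
  have /sigma_finiteP[G [TG ndG Goo]] := sigma_finiteT mu.
  exists (fun i => F i `*` G i).
    rewrite -setXTT TF TG predeqE => -[x y]; split.
      move=> [/= [i _ Fx] [j _ Gy]]; exists (maxn i j) => //; split.
        by move: x Fx; exact/subsetPset/ndF/leq_maxl.
      by move: y Gy; exact/subsetPset/ndG/leq_maxr.
    by move=> [i _ []/= ? ?]; split; exists i.
  move=> i; have [? ?] := Foo i; have [? ?] := Goo i.
  split; first exact: measurableX.
  by rewrite product_measure1E// lte_mul_pinfty// ge0_fin_numE.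
pose g (t : n.+1.-tuple R) : R * n.-tuple R := (thead t, [tuple of behead t]).
have mg : measurable_fun [set: _] g.
  apply/measurable_fun_pair; first exact: measurable_tnth.
  exact: measurable_behead.
have gK : cancel (@cons_pair n) g.
  by case=> x t; rewrite /g /cons_pair theadE; congr pair; exact: val_inj.
exists (fun i => g @^-1` F i).
  by rewrite -preimage_bigcup -FT preimage_setT.
move=> i; have [mF ltF] := Foo i; split.
  by rewrite -[X in measurable X]setTI; exact: mg.
rewrite /lebesgue_cons /pushforward -comp_preimage.
by rewrite (_ : g \o _ = id)//; apply/funext => x; exact: gK.
Qed.

HB.instance Definition _ := @Measure_isSigmaFinite.Build _ _ _ lebesgue_cons
  lebesgue_cons_sigma_finite.

End Step.

(* n-dimensional Lebesgue measure, as the iterated product of the Lebesgue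
   measure on R transported along R * R^n = R^(n+1). *)
Fixpoint lebesgue_tuple n : {sigma_finite_measure set (n.-tuple R) -> \bar R} :=
  match n with
  | 0 => \d_ [tuple]
  | m.+1 => lebesgue_cons (lebesgue_tuple m)
  end.

End LebesgueTuple.

Section Lattice.
Context {R : realType}.

(* The lattice h Z^n, as a subtype of R^n, with the discrete sigma-algebra. *)
Definition hZ (h : R) (n : nat) : Type :=
  set_type (range (fun z : 'rV[int]_n => h *: map_mx intr z)).

HB.instance Definition _ (h : R) n := Choice.on (hZ h n).
HB.instance Definition _ (h : R) n :=
  isPointed.Build (hZ h n) (SigSub (mem_set (imageT _ (0 : 'rV[int]_n)))).
HB.instance Definition _ (h : R) n :=
  @isMeasurable.Build default_measure_display (hZ h n) discrete_measurable
    discrete_measurable0 discrete_measurableC discrete_measurableU.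

Definition hZ_val (h : R) n (k : hZ h n) : 'rV[R]_n := set_val k.

Section Symbols.
Variables (h : R) (n : nat).
Implicit Types (k m : hZ h n) (theta : n.-tuple R) (a b : hZ h n -> R[i]).

(* Functions on R^n / Z^n are represented by functions on R^n of which only the
   values on the fundamental domain [0, 1)^n are used. *)
Definition torus : set (n.-tuple R) :=
  [set theta | forall i, tnth theta i \in `[0, 1[].

Definition dot (x : 'rV[R]_n) theta : R := \sum_i x 0 i * tnth theta i.

Definition expi (t : R) : R[i] := cos t +i* sin t.

Definition torus_integral (f : n.-tuple R -> R[i]) : R[i] :=
  (\int[lebesgue_tuple n]_(theta in torus) complex.Re (f theta))%R +i*
  (\int[lebesgue_tuple n]_(theta in torus) complex.Im (f theta))%R.

Definition is_symbol (sigma : hZ h n -> n.-tuple R -> R[i]) : Prop :=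
  [/\ measurable_fun ([set: hZ h n] `*` torus)
        (fun x => complex.Re (sigma x.1 x.2)),
      measurable_fun ([set: hZ h n] `*` torus)
        (fun x => complex.Im (sigma x.1 x.2)) &
      forall k,
        (lebesgue_tuple n).-integrable torus
          (EFin \o (fun theta => complex.Re (sigma k theta))) /\
        (lebesgue_tuple n).-integrable torus
          (EFin \o (fun theta => complex.Im (sigma k theta)))].

Definition fourier (sigma : hZ h n -> n.-tuple R -> R[i]) k m : R[i] :=
  torus_integral (fun theta =>
    sigma k theta * expi (- (2 * pi / h * dot (hZ_val m) theta))).

Definition symbol_matrix (sigma : hZ h n -> n.-tuple R -> R[i]) k m : R[i] :=
  torus_integral (fun theta =>
    sigma k theta * expi (2 * pi / h * dot (hZ_val k - hZ_val m) theta)).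

(* [R[i]^o] selects R[i] as a normed module over itself, so that series below
   are unordered sums in the topology of the complex plane. *)
Definition psdo_term (sigma : hZ h n -> n.-tuple R -> R[i]) a k m : R[i]^o :=
  symbol_matrix sigma k m * a m.

Definition psdo (sigma : hZ h n -> n.-tuple R -> R[i]) a k : R[i] :=
  summability.sum (psdo_term sigma a k).

Definition lp (p : \bar R) a : Prop :=
  finite_norm counting p (fun k => normc (a k)).

Definition lp_norm (p : \bar R) a : \bar R :=
  'N[counting]_p[EFin \o (fun k => normc (a k))]%E.

Definition bounded_linear (p r : \bar R)
    (T : (hZ h n -> R[i]) -> hZ h n -> R[i]) : Prop :=
  [/\ forall a, lp p a -> lp r (T a),
      forall (c : R[i]) a b k, lp p a -> lp p b ->
        T (fun m => c * a m + b m) k = c * T a k + T b k &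
      exists M : R, forall a, lp p a ->
        (lp_norm r (T a) <= M%:E * lp_norm p a)%E].

(* The total function [psdo] has a junk value where the series diverges, hence
   the explicit convergence clause. *)
Definition psdo_bounded (p r : \bar R) (sigma : hZ h n -> n.-tuple R -> R[i]) :
    Prop :=
  (forall a k, lp p a ->
     cvg (summability.partial_sum (psdo_term sigma a k)
            @ summability.totally)) /\
  bounded_linear p r (psdo sigma).

End Symbols.
End Lattice.

(* Main.v *)
Require Import Defs.
From HB Require Import structures.
From mathcomp Require Import all_boot all_order all_algebra finmap.
From mathcomp Require Import all_classical all_reals all_analysis.
From mathcomp Require Import measurable_realfun ess_sup_inf.
From mathcomp Require summability.
From mathcomp Require Import complex.

(** The entry of index [(k, m)] of the matrix of [sigma] is the Fourier
    coefficient of [sigma k] at [m - k], so the hypothesis bounds it by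
    [`|C k| * `|omega (m - k)|].  Hence, for conjugate exponents [p] and [q],
    Hoelder's inequality on the row [k] gives

      sum_m |a_(k, m) a(m)| <= |C k| * ||omega (. - k)||_q * ||a||_p,

    and [||omega (. - k)||_q = ||omega||_q] because translations permute the
    lattice and the counting measure does not see permutations.  Every row
    series therefore converges absolutely, and [|T a (k)| <= K * |C k|] with
    [K = ||omega||_q * ||a||_p], whence

      ||T a||_r <= ||C||_r * ||omega||_q * ||a||_p

    for every [r >= 1].  This is [psdo_bounded_conjugate]; the three claims are
    its instances [(p, q, r) := (1, +oo, p)], [(1, +oo, +oo)] and [(p, q, p)].

    The unordered complex series are handled by reduction to real ones: a
    family with bounded sums of moduli is summable because its real and
    imaginary parts are differences of nonnegative families, whose partial sums
    are monotone and bounded ([cvg_partial_sum_normc]).  The row estimate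
    transfers to partial sums since these are bounded by integrals against the
    counting measure ([sum_le_integral_counting]), where Hoelder's inequality
    is available, extended here to the pair [(1, +oo)] ([hoelder_counting]). *)

Set Implicit Arguments.
Unset Strict Implicit.
Unset Printing Implicit Defensive.

Import Order.TTheory GRing.Theory Num.Theory.
Import numFieldNormedType.Exports.
Import ComplexField.Normc.

Local Open Scope classical_set_scope.
Local Open Scope ring_scope.

#[local] Existing Instance summability.totally_filter.

(** * Unordered sums of real and complex families *)

Section ComplexModulus.
Context {R : realType}.
Implicit Types z : R[i].

Lemma normc_ge0 z : 0 <= normc z.
Proof. by case: z => a b; exact: sqrtr_ge0. Qed.

Lemma normc_ge_Re z : `|complex.Re z| <= normc z.
Proof.
by case: z => a b /=; rewrite -sqrtr_sqr ler_wsqrtr// lerDl sqr_ge0.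
Qed.

Lemma normc_ge_Im z : `|complex.Im z| <= normc z.
Proof.
by case: z => a b /=; rewrite -sqrtr_sqr ler_wsqrtr// lerDr sqr_ge0.
Qed.

Lemma normc_le_ReIm z :
  normc z <= `|complex.Re z| + `|complex.Im z|.
Proof.
case: z => a b /=; rewrite -[leRHS]ger0_norm ?addr_ge0// -sqrtr_sqr.
rewrite ler_wsqrtr// sqrrD !real_normK ?num_real//.
by rewrite -addrA lerD2l lerDr mulrn_wge0 ?mulr_ge0.
Qed.

(** In the order of [R[i]] the positive elements are the positive reals, so the
    radii in the definition of convergence may be taken in [R]. *)
Lemma cvg_complexP {T : Type} {F : set_system T} {FF : Filter F}
    (f : T -> R[i]^o) (z : R[i]^o) :
  f @ F --> z <->
  forall e : R, 0 < e -> \forall J \near F, normc (z - f J) < e.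
Proof.
split=> [/cvgrPdist_lt fz e e0|fz].
  have /fz : (0 : R[i]) < (e%:C)%C by rewrite ltcR.
  by apply: filterS => J; rewrite ltcR.
apply/cvgrPdist_lt => -[e e'] /=; rewrite ltcE/= => /andP[/eqP -> e0].
by apply: filterS (fz _ e0) => J; rewrite -ltcR.
Qed.

End ComplexModulus.

Section Summability.
Context {R : realType} {I : choiceType}.
Implicit Types (J : {fset I}) (M : R).

Lemma partial_sumE (V : zmodType) (x : I -> V) J :
  summability.partial_sum x J = \sum_(i <- J) x i.
Proof. by rewrite big_seq_fsetE. Qed.

Lemma le_partial_sum (x : I -> R) J K : (forall i, 0 <= x i) ->
  (J `<=` K)%fset -> summability.partial_sum x J <= summability.partial_sum x K.
Proof.
move=> x0 JK; rewrite !partial_sumE.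
rewrite [leRHS](big_fsetID _ (fun i => i \in J)) /=.
rewrite [X in _ <= X + _](_ : _ = \sum_(i <- J) x i).
  by rewrite lerDl sumr_ge0.
apply: eq_fbigl => i; rewrite !inE/=; apply/andP/idP => [[]//|iJ].
by split=> //; exact: (fsubsetP JK).
Qed.

(** By monotonicity the partial sums converge to their supremum. *)
Lemma cvg_partial_sum_ge0 (x : I -> R) M : (forall i, 0 <= x i) ->
  (forall J, summability.partial_sum x J <= M) ->
  cvg (summability.partial_sum x @ summability.totally).
Proof.
move=> x0 xM; set E := range (summability.partial_sum x).
have supE : has_sup E.
  split; first by exists (summability.partial_sum x fset0), fset0.
  by exists M => _ [J _ <-].
apply/cvg_ex; exists (sup E); apply/cvgrPdist_lt => /= e e0.
have [_ [J _ <-] Je] := sup_adherent e0 supE.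
exists J => // K /= JK.
have := le_partial_sum x0 JK.
have : summability.partial_sum x K <= sup E.
  by apply: ub_le_sup; [case: supE|exists K].
move=> xK xJK; rewrite ger0_norm ?subr_ge0//.
by rewrite ltrBlDr -ltrBlDl (lt_le_trans Je).
Qed.

(** Write [x] as the difference of the nonnegative families [x + |x|] and
    [|x|]. *)
Lemma cvg_partial_sum_abs (x : I -> R) M :
  (forall J, summability.partial_sum (fun i => `|x i|) J <= M) ->
  cvg (summability.partial_sum x @ summability.totally).
Proof.
move=> xM.
have abs_cvg : cvg (summability.partial_sum (fun i => `|x i|)
    @ summability.totally).
  exact: cvg_partial_sum_ge0 xM.
have pos_cvg : cvg (summability.partial_sum (fun i => x i + `|x i|)
    @ summability.totally).
  apply: (@cvg_partial_sum_ge0 _ (M + M)) => [i|J].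
    by rewrite -lerBlDl sub0r -normrN ler_norm.
  rewrite /summability.partial_sum big_split /= lerD//; last exact: xM.
  apply: le_trans (xM J); apply: ler_sum => i _; exact: ler_norm.
have -> : summability.partial_sum x =
    summability.partial_sum (fun i => x i + `|x i|) \-
    summability.partial_sum (fun i => `|x i|).
  apply/funext => J; rewrite /summability.partial_sum /= -sumrB.
  by apply: eq_bigr => i _; rewrite addrK.
exact: is_cvgB.
Qed.

Lemma normc_partial_sum_le (x : I -> R[i]) J :
  normc (summability.partial_sum x J) <=
  summability.partial_sum (fun i => normc (x i)) J.
Proof.
rewrite /summability.partial_sum.
elim/big_ind2 : _ => [|z1 r1 z2 r2 H1 H2|//]; first by rewrite normc0.
by rewrite (le_trans (le_normcD _ _))// lerD.
Qed.

Lemma Re_partial_sum (x : I -> R[i]) J :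
  complex.Re (summability.partial_sum x J) =
  summability.partial_sum (fun i => complex.Re (x i)) J.
Proof. by rewrite /summability.partial_sum raddf_sum. Qed.

Lemma Im_partial_sum (x : I -> R[i]) J :
  complex.Im (summability.partial_sum x J) =
  summability.partial_sum (fun i => complex.Im (x i)) J.
Proof. by rewrite /summability.partial_sum raddf_sum. Qed.

(** The limit is assembled from those of the real and imaginary parts, which
    avoids any appeal to completeness of [R[i]]. *)
Lemma cvg_partial_sum_normc (x : I -> R[i]^o) M :
  (forall J, summability.partial_sum (fun i => normc (x i)) J <= M) ->
  cvg (summability.partial_sum x @ summability.totally).
Proof.
move=> xM.
have cRe : cvg (summability.partial_sum (fun i => complex.Re (x i))
    @ summability.totally).
  apply: (@cvg_partial_sum_abs _ M) => J; apply: le_trans (xM J).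
  by apply: ler_sum => i _; exact: normc_ge_Re.
have cIm : cvg (summability.partial_sum (fun i => complex.Im (x i))
    @ summability.totally).
  apply: (@cvg_partial_sum_abs _ M) => J; apply: le_trans (xM J).
  by apply: ler_sum => i _; exact: normc_ge_Im.
have [u /cvgrPdist_lt uP] := (cvg_ex _).1 cRe.
have [v /cvgrPdist_lt vP] := (cvg_ex _).1 cIm.
apply/cvg_ex; exists (u +i* v)%C; apply/cvg_complexP => e e0.
have e20 : 0 < e / 2 by rewrite divr_gt0.
near=> J; rewrite (le_lt_trans (normc_le_ReIm _))//.
rewrite [e]splitr ltrD//.
  rewrite raddfB /= Re_partial_sum; near: J; exact: uP.
rewrite raddfB /= Im_partial_sum; near: J; exact: vP.
Unshelve. all: by end_near. Qed.

Lemma normc_sum_le (x : I -> R[i]^o) M :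
  (forall J, summability.partial_sum (fun i => normc (x i)) J <= M) ->
  normc (summability.sum x) <= M.
Proof.
move=> xM; have /cvg_complexP limx := cvg_partial_sum_normc xM.
apply/ler_addgt0Pr => e /limx sume.
have [J Je] := filter_ex sume.
rewrite -[summability.sum x](subrK (summability.partial_sum x J)).
rewrite (le_trans (le_normcD _ _))// addrC lerD//; last exact: ltW.
exact: le_trans (normc_partial_sum_le _ _) (xM J).
Qed.

End Summability.

(** * The counting measure on a discrete space *)

Section Counting.
Context d {T : measurableType d} {R : realType}.
Hypothesis discT : forall A : set T, measurable A.
Local Open Scope ereal_scope.
Local Notation counting := (@counting T R).

Lemma discrete_measurable_fun d' (U : measurableType d') (f : T -> U) D :
  measurable_fun D f.
Proof. by move=> *; exact: discT. Qed.

Lemma counting_set1 (x : T) : counting [set x] = 1.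
Proof.
by rewrite /counting_measure.counting asboolT// fset_set1 cardfs1.
Qed.

(** The empty set is the only null set, as a singleton has measure 1. *)
Lemma counting_ae (P : T -> Prop) :
  (\forall x \ae counting, P x) -> forall x, P x.
Proof.
move=> [N [_ N0 PN]] x; apply: contrapT => nPx.
have : counting [set x] <= counting N.
  by apply: le_measure; [exact/mem_set|exact/mem_set|move=> _ ->; exact: PN].
by rewrite N0 counting_set1 lee_fin ler10.
Qed.

(** The finite sum is the integral over the finite set of its indices. *)
Lemma sum_le_integral_counting (f : T -> R) (J : {fset T}) :
  (forall x, 0 <= f x)%R ->
  (summability.partial_sum f J)%:E <= \int[counting]_x (f x)%:E.
Proof.
move=> f0; rewrite partial_sumE -sumEFin.
have -> : \sum_(i <- J) (f i)%:E =
    \int[counting]_(x in \big[setU/set0]_(i <- J) [set i]) (f x)%:E.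
  rewrite ge0_integral_bigsetU//=.
  - apply: eq_bigr => i _.
    rewrite (eq_integral (cst (f i)%:E)); last by move=> x /[!inE] ->.
    by rewrite integral_cst// [X in _ * X]counting_set1 mule1.
  - by move=> i j _ _ [x [-> ->]].
  - by move=> x _; rewrite lee_fin.
by apply: ge0_subset_integral => // x _; rewrite lee_fin.
Qed.

Lemma counting_preimage (f : T -> T) (A : set T) : bijective f ->
  counting (f @^-1` A) = counting A.
Proof.
move=> [g fK gK].
have -> : f @^-1` A = g @` A.
  apply/seteqP; split => [x Ax|_ [y Ay <-]]; first by exists (f x).
  by rewrite /preimage/= gK.
have ginj : injective g := can_inj gK.
rewrite /counting_measure.counting.
case: ifPn => [/asboolP fA|/asboolPn iA].
  have fA' : finite_set A.
    have := finite_image f fA.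
    by rewrite image_comp (_ : f \o g = id) ?image_id//; apply/funext.
  rewrite asboolT// fset_set_image// card_imfset//.
rewrite asboolF// => fA; apply: iA; exact: finite_image.
Qed.

(** For finite [p] this is a change of variables, [f] preserving the measure;
    for [p = +oo] both sides are suprema over all points. *)
Lemma Lnorm_counting_comp (f : T -> T) (w : T -> \bar R) p : bijective f ->
  1 <= p -> 'N[counting]_p[w \o f] = 'N[counting]_p[w].
Proof.
move=> bijf; case: p => [r r1|_|//]; rewrite unlock /=.
  congr (_ `^ _).
  have mf : measurable_fun setT f by exact: discrete_measurable_fun.
  rewrite -[LHS](@ge0_integral_pushforward _ _ _ _ _ f mf counting setT
    (fun x => `|w x| `^ r))//; last first.
    by move=> x _; exact: poweR_ge0.
  apply: eq_measure_integral => A _ _; exact: counting_preimage.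
case: ifPn => // _.
apply/eqP; rewrite eq_le; apply/andP; split; apply/ess_supP/nearW => x /=.
  have /(_ (f x)) := counting_ae (ess_sup_ge counting (abse \o w)); exact.
case: bijf => g _ gK.
have /(_ (g x)) := counting_ae (ess_sup_ge counting (abse \o (w \o f))).
by rewrite /= gK.
Qed.

Lemma Lnorm_le_scale p (f g : T -> R) (K : R) : 1 <= p -> (0 <= K)%R ->
  (forall x, `|g x| <= K * `|f x|)%R ->
  'N[counting]_p[EFin \o g] <= K%:E * 'N[counting]_p[EFin \o f].
Proof.
case: p => [r|_|//] => [r1|] K0 gf; rewrite unlock/=; last first.
  case: ifPn => cT; last by rewrite mule0.
  apply/ess_supP/nearW => x /=.
  apply: (@le_trans _ _ (K%:E * (`|f x|)%:E)); first by rewrite -EFinM lee_fin.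
  apply: lee_wpmul2l; first by rewrite lee_fin.
  have /(_ x) := counting_ae (ess_sup_ge counting (abse \o (EFin \o f))); exact.
have r0 : (0 < r)%R by rewrite -lte_fin (lt_le_trans lte01).
have -> : K%:E = (K%:E `^ r) `^ r^-1.
  by rewrite -poweRrM mulfV ?gt_eqF// poweRe1// lee_fin.
have If u : 0 <= \int[counting]_x (`|u x : R| `^ r)%:E.
  by apply: integral_ge0 => x _; rewrite lee_fin powR_ge0.
rewrite poweR_EFin -poweRM ?lee_fin ?powR_ge0//.
apply: gt0_ler_poweR.
- by rewrite invr_ge0 ltW.
- by rewrite in_itv/= leey andbT.
- by rewrite in_itv/= leey andbT mule_ge0// lee_fin powR_ge0.
rewrite -ge0_integralZl//; last by rewrite lee_fin powR_ge0.
apply: ge0_le_integral => //.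
move=> x _; rewrite -EFinM -powRM// lee_fin.
by rewrite ge0_ler_powR ?nnegrE ?mulr_ge0// ltW.
Qed.

(** Two finite exponents are the case of Hoelder's inequality for real
    exponents.  If one exponent is infinite, then the other is 1, and it
    suffices to bound one factor by its supremum. *)
Lemma hoelder_counting (f g : T -> R) (p q : \bar R) :
  1 <= p -> 1 <= q -> p^-1 + q^-1 = 1 ->
  \int[counting]_x (`|f x * g x|)%:E <=
  'N[counting]_p[EFin \o f] * 'N[counting]_q[EFin \o g].
Proof.
move=> p1 q1 pq.
have hoelder_1y (u v : T -> R) : \int[counting]_x (`|u x * v x|)%:E <=
    'N[counting]_1[EFin \o u] * 'N[counting]_+oo[EFin \o v].
  (* when [v] is unbounded the right-hand side is [0 * +oo = 0] or [+oo], and in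
     the former case [u] vanishes everywhere *)
  have [vy|vy] := eqVneq ('N[counting]_+oo[EFin \o v]) +oo.
    have [u0|u0] := eqVneq ('N[counting]_1[EFin \o u]) 0.
      have mu : measurable_fun [set: T] (EFin \o u).
        by move=> *; exact: discT.
      have /counting_ae u0' := Lnorm_eq0_eq0 mu lte01 u0.
      rewrite u0 mul0e integral0_eq// => x _.
      by have /(_ I) [->] := u0' x; rewrite mul0r normr0.
    by rewrite vy gt0_muley ?leey// lt0e u0 Lnorm_ge0.
  set V := 'N[counting]_+oo[EFin \o v] in vy *.
  have Vfin : V \is a fin_num.
    by rewrite ge0_fin_numE ?Lnorm_ge0// ltey.
  have vV x : (`|v x| <= fine V)%R.
    rewrite -lee_fin fineK// /V unlock.
    have -> : 0 < counting [set: T].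
      rewrite (@lt_le_trans _ _ (counting [set x]))//.
        by rewrite counting_set1 lte01.
      by apply: le_measure; [exact/mem_set|exact/mem_set|].
    have /(_ x) := counting_ae (ess_sup_ge counting (abse \o (EFin \o v))).
    exact.
  rewrite Lnorm1 -[V]fineK// muleC -ge0_integralZl//; last first.
    by rewrite lee_fin fine_ge0// Lnorm_ge0.
  apply: ge0_le_integral => //.
  by move=> x _; rewrite abse_EFin -EFinM lee_fin normrM mulrC ler_wpM2r.
case: p p1 pq => [r r1|_|//].
  case: q q1 => [s s1|_|//].
    have r0 : (0 < r)%R by rewrite -lte_fin (lt_le_trans lte01).
    have s0 : (0 < s)%R by rewrite -lte_fin (lt_le_trans lte01).
    rewrite !inver !gt_eqF// => -[rs].
    have := @hoelder _ _ _ counting f g r s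
      (@discrete_measurable_fun _ _ f setT)
      (@discrete_measurable_fun _ _ g setT) r0 s0 rs.
    by rewrite Lnorm1.
  rewrite invey adde0 => /eqP; rewrite inve_eq1 => /eqP[->].
  exact: hoelder_1y.
rewrite invey add0e => /eqP; rewrite inve_eq1 => /eqP ->.
rewrite muleC; under eq_integral do rewrite mulrC.
exact: hoelder_1y.
Qed.

Lemma finite_norm_fineK p (f : T -> R) : finite_norm counting p f ->
  (fine 'N[counting]_p[EFin \o f])%:E = 'N[counting]_p[EFin \o f].
Proof. by move=> fp; rewrite fineK// ge0_fin_numE// Lnorm_ge0. Qed.

End Counting.

(** * Translations of the lattice and the matrix of a symbol *)

Section Lattice.
Context {R : realType} {h : R} {n : nat}.
Implicit Types k m : hZ h n.

Lemma hZ_sub_subproof m k :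
  range (fun z : 'rV[int]_n => h *: map_mx intr z) (hZ_val m - hZ_val k).
Proof.
case: m => x /[dup] /set_mem [z _ zx] mx.
case: k => y /[dup] /set_mem [w _ wy] my.
by exists (z - w) => //; rewrite map_mxB scalerBr zx wy.
Qed.

Definition hZ_sub m k : hZ h n := SigSub (mem_set (hZ_sub_subproof m k)).

Lemma hZ_val_sub m k : hZ_val (hZ_sub m k) = hZ_val m - hZ_val k.
Proof. by []. Qed.

Lemma hZ_val_inj : injective (@hZ_val R h n).
Proof. exact: val_inj. Qed.

Lemma hZ_val_point : hZ_val (point : hZ h n) = 0.
Proof. by apply/rowP => j; rewrite !mxE mulr0. Qed.

(** The inverse translates by [- k], that is, by [point - k] since [point] is
    the origin of the lattice. *)
Lemma hZ_sub_bij k : bijective (hZ_sub^~ k).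
Proof.
exists (hZ_sub^~ (hZ_sub point k)) => m; apply: hZ_val_inj;
  by rewrite !hZ_val_sub hZ_val_point sub0r opprK ?subrK ?addrK.
Qed.

Lemma symbol_matrixE (sigma : hZ h n -> n.-tuple R -> R[i]) k m :
  symbol_matrix sigma k m = fourier sigma k (hZ_sub m k).
Proof.
congr torus_integral; apply/funext => theta.
by rewrite hZ_val_sub -mulrN /dot -sumrN; congr (_ * expi (_ * _));
  apply: eq_bigr => i _; rewrite !mxE -mulNr opprB.
Qed.

End Lattice.

(** * Boundedness of the operator *)

Section Operator.
Context {R : realType} {h : R} {n : nat}.
Variables (sigma : hZ h n -> n.-tuple R -> R[i]) (C omega : hZ h n -> R).
Hypothesis fourier_bound : forall k m,
  normc (fourier sigma k m) <= C k * omega m.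
Implicit Types (a b : hZ h n -> R[i]) (k m : hZ h n) (J : {fset hZ h n}).

Let disc (A : set (hZ h n)) : measurable A.
Proof. by []. Qed.

(** Hoelder's inequality on the row [k], with the translate of [omega] replaced
    by [omega] itself. *)
Lemma psdo_term_partial_sum_le (p q : \bar R) a k J :
  (1 <= p)%E -> (1 <= q)%E -> (p^-1 + q^-1 = 1)%E ->
  finite_norm counting q omega -> lp p a ->
  summability.partial_sum (fun m => normc (psdo_term sigma a k m)) J <=
  `|C k| * (fine ('N[counting]_q[EFin \o omega])%E * fine (lp_norm p a)).
Proof.
move=> p1 q1 pq wq ap.
pose f m := `|normc (a m) * omega (hZ_sub m k)|.
apply: (@le_trans _ _ (`|C k| * summability.partial_sum f J)).
  rewrite /summability.partial_sum mulr_sumr; apply: ler_sum => i _.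
  rewrite /psdo_term /f normcM symbol_matrixE normrM mulrCA -normrM mulrC.
  rewrite ger0_norm; last exact: normc_ge0.
  apply: ler_wpM2l; first exact: normc_ge0.
  exact: le_trans (fourier_bound _ _) (ler_norm _).
apply: ler_wpM2l => //; rewrite -lee_fin EFinM.
rewrite !finite_norm_fineK// muleC.
have f0 x : 0 <= f x by rewrite normr_ge0.
apply: le_trans (sum_le_integral_counting disc J f0) _.
rewrite -(Lnorm_counting_comp disc (EFin \o omega) (hZ_sub_bij k) q1).
exact: (hoelder_counting disc (fun m => normc (a m))
  (fun m => omega (hZ_sub m k)) p1 q1 pq).
Qed.

(** The row estimate bounds [psdo sigma a] pointwise by a multiple of [C], so
    that the exponent [r] of the target space only has to suit [C]. *)
Lemma psdo_bounded_conjugate (p q r : \bar R) :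
  (1 <= p)%E -> (1 <= q)%E -> (p^-1 + q^-1 = 1)%E -> (1 <= r)%E ->
  finite_norm counting r C -> finite_norm counting q omega ->
  psdo_bounded p r sigma.
Proof.
move=> p1 q1 pq r1 Cr wq.
have termle a k J ap := @psdo_term_partial_sum_le p q a k J p1 q1 pq wq ap.
have psdo_cvg a k : lp p a -> cvg (summability.partial_sum (psdo_term sigma a k)
    @ summability.totally).
  by move=> ap; apply: cvg_partial_sum_normc => J; exact: termle.
set W := fine ('N[counting]_q[EFin \o omega])%E in termle.
have W0 : 0 <= W by rewrite fine_ge0// Lnorm_ge0.
have normle a : lp p a -> (lp_norm r (psdo sigma a) <=
    (W * fine (lp_norm p a))%:E * 'N[counting]_r[EFin \o C])%E.
  move=> ap; apply: Lnorm_le_scale => //.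
    by rewrite mulr_ge0// fine_ge0// Lnorm_ge0.
  move=> k; rewrite ger0_norm; last exact: normc_ge0.
  by rewrite mulrC; apply: normc_sum_le => J; exact: termle.
split=> //; split.
- move=> a ap; apply: le_lt_trans (normle a ap) _.
  by rewrite -(finite_norm_fineK Cr) -EFinM ltry.
- move=> c a b k ap bp.
  have lim_ab : summability.partial_sum
      (psdo_term sigma (fun m => c * a m + b m) k) @ summability.totally -->
      (c *: (psdo sigma a k : R[i]^o) + (psdo sigma b k : R[i]^o)).
    rewrite (_ : summability.partial_sum _ =
      (c \*: summability.partial_sum (psdo_term sigma a k)) \+
      summability.partial_sum (psdo_term sigma b k)); last first.
      apply/funext => J /=; rewrite /summability.partial_sum scaler_sumr.
      rewrite -big_split /=; apply: eq_bigr => i _.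
      by rewrite /psdo_term mulrDr mulrCA.
    apply: cvgD; last exact: psdo_cvg.
    by apply: cvgZl_tmp; exact: psdo_cvg.
  exact: (cvg_lim (@norm_hausdorff _ _)) lim_ab.
exists (W * fine ('N[counting]_r[EFin \o C])%E) => a ap.
apply: le_trans (normle a ap) _.
by rewrite -(finite_norm_fineK Cr) -[X in (_ <= _ * X)%E](finite_norm_fineK ap)
  -!EFinM lee_fin mulrAC.
Qed.

End Operator.

Theorem theorem4 (R : realType) (n : nat) (n_ge1 : (1 <= n)%N)
    (h : R) (h_gt0 : 0 < h)
    (sigma : hZ h n -> n.-tuple R -> R[i]) (sigma_symbol : is_symbol sigma)
    (C omega : hZ h n -> R)
    (fourier_bound : forall k m : hZ h n,
       normc (fourier sigma k m) <= C k * omega m)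
    (p q : \bar R) (p_ge1 : (1 <= p)%E) (q_ge1 : (1 <= q)%E)
    (conj_pq : (p^-1 + q^-1 = 1)%E) :
  [/\ (p < +oo)%E ->
        finite_norm counting p C -> finite_norm counting +oo%E omega ->
        psdo_bounded 1%E p sigma,
      finite_norm counting +oo%E C -> finite_norm counting +oo%E omega ->
        psdo_bounded 1%E +oo%E sigma
    & (1 < p)%E ->
        finite_norm counting p C -> finite_norm counting q omega ->
        psdo_bounded p p sigma].
Proof.
have conj_1y : (1^-1 + +oo^-1 = 1 :> \bar R)%E by rewrite inve1 invey adde0.
split=> [_||_] C_fin omega_fin.
- by apply: (psdo_bounded_conjugate fourier_bound _ _ conj_1y); rewrite ?leey.
- by apply: (psdo_bounded_conjugate fourier_bound _ _ conj_1y); rewrite ?leey.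
- exact: (psdo_bounded_conjugate fourier_bound p_ge1 q_ge1 conj_pq).
Qed.
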